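(* Let $(A,\Delta)$ be a finite quantum hypergroup. Let $B$ be the dual space of $A$, with product and coproduct $\Delta$ adjoint to the coproduct and product of $A$, i.e. $\langle a,bb'\rangle=\langle\Delta(a),b\otimes b'\rangle$ and $\langle a\otimes a',\Delta(b)\rangle=\langle aa',b\rangle$ for $a,a'\in A$ and $b,b'\in B$, where $\langle a,b\rangle$ denotes the value of $b$ at $a$. Then $(B,\Delta)$ is again a finite quantum hypergroup.
   Context: All algebras are finite-dimensional, associative and unital over $\mathbb C$. A coproduct on $A$ is a linear map $\Delta:A\to A\otimes A$ with $(\Delta\otimes\iota)\Delta=(\iota\otimes\Delta)\Delta$ (not assumed multiplicative); $\iota$ is the identity map. A counit is a linear map $\varepsilon:A\to\mathbb C$ with $(\varepsilon\otimes\iota)\Delta(a)=a=(\iota\otimes\varepsilon)\Delta(a)$ for all $a$ (it is unique). A linear functional $\omega$ on $A$ is faithful if $\omega(ac)=0$ for all $c$ implies $a=0$, and $\omega(ac)=0$ for all $a$ implies $c=0$. A linear functional $\varphi$ on $A$ is a left integral if there is a linear map $S:A\to A$ with $S((\iota\otimes\varphi)(\Delta(a)(1\otimes c)))=(\iota\otimes\varphi)((1\otimes a)\Delta(c))$ for all $a,c\in A$. If $\varphi$ is faithful, $S$ is unique and called the antipode of $\varphi$. A finite quantum hypergroup is a pair $(A,\Delta)$ of a finite-dimensional unital algebra $A$ with a coproduct $\Delta$ admitting a counit $\varepsilon$, such that there is a faithful left integral on $A$, the coproduct is unital ($\Delta(1)=1\otimes1$), the counit is an algebra homomorphism, and the antipode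 associated with the integral is an anti-isomorphism of the algebra $A$ (bijective linear with $S(xy)=S(y)S(x)$). *)

(* Defs.v *)
From HB Require Import structures.
From mathcomp Require Import all_boot all_algebra all_field.
From mathcomp Require Import boolp.

Set Implicit Arguments.
Unset Strict Implicit.
Unset Printing Implicit Defensive.

Import GRing.Theory.
Local Open Scope ring_scope.

Section Tensor.
Variable K : fieldType.
Implicit Types U V W : vectType K.

Definition basis U (i : 'I_(\dim {:U})) : U := (vbasis {:U})`_i.

Lemma basis_expand U (u : U) :
  u = \sum_i coord (vbasis {:U}) i u *: basis i.
Proof. exact: coord_vbasis (memvf u). Qed.

Lemma coord_basis U (i j : 'I_(\dim {:U})) :
  coord (vbasis {:U}) i (basis j) = (j == i)%:R.
Proof. exact: coord_free (basis_free (vbasisP _)). Qed.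

(* The algebraic tensor product of U and V, an element being represented by its
   matrix of coordinates in the family basis i \ox basis j.  The lemmas
   tensor_linearl, tensor_linearr, tliftE and tlift_unique below are its
   universal property. *)
Definition tensor U V : Type := 'M[K]_(\dim {:U}, \dim {:V}).

HB.instance Definition _ U V := Vector.copy (tensor U V)
  'M[K]_(\dim {:U}, \dim {:V}).

Definition tens U V (u : U) (v : V) : tensor U V :=
  \matrix_(i, j) (coord (vbasis {:U}) i u * coord (vbasis {:V}) j v).

Definition tlift_fun U V W (f : U -> V -> W) (t : tensor U V) : W :=
  \sum_i \sum_j (t : 'M_(_, _)) i j *: f (basis i) (basis j).

Fact tlift_fun_linear U V W (f : U -> V -> W) : linear (tlift_fun f).
Proof.
move=> a s t; rewrite /tlift_fun scaler_sumr -big_split; apply: eq_bigr => i _.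
rewrite scaler_sumr -big_split; apply: eq_bigr => j _ /=.
by rewrite !mxE scalerDl scalerA.
Qed.
HB.instance Definition _ U V W (f : U -> V -> W) :=
  GRing.isSemilinear.Build K (tensor U V) W _ (tlift_fun f)
    (GRing.semilinear_linear (tlift_fun_linear f)).

(* For bilinear f, the linear map sending u \ox v to f u v. *)
Definition tlift U V W (f : U -> V -> W) : 'Hom(tensor U V, W) :=
  linfun (tlift_fun f).

End Tensor.

Notation "u \ox v" := (tens u v) (at level 40, left associativity).

Section TensorTheory.
Variable K : fieldType.
Implicit Types U V W : vectType K.

Lemma tensor_linearl U V (v : V) : linear (fun u : U => u \ox v).
Proof.
by move=> a u u'; apply/matrixP=> i j; rewrite !mxE linearP mulrDl mulrA.
Qed.

Lemma tensor_linearr U V (u : U) : linear (fun v : V => u \ox v).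
Proof.
by move=> a v v'; apply/matrixP=> i j; rewrite !mxE linearP mulrDr mulrCA.
Qed.

Lemma tliftE U V W (f : U -> V -> W) (u : U) (v : V) :
  (forall v, linear (f^~ v)) -> (forall u, linear (f u)) ->
  tlift f (u \ox v) = f u v.
Proof.
move=> fl fr; rewrite lfunE /= /tlift_fun.
pose gr x := HB.pack (f x) (GRing.isSemilinear.Build K V W _ (f x)
  (GRing.semilinear_linear (fr x))) : {linear V -> W}.
pose gl := HB.pack (f^~ v) (GRing.isSemilinear.Build K U W _ (f^~ v)
  (GRing.semilinear_linear (fl v))) : {linear U -> W}.
transitivity (\sum_i coord (vbasis {:U}) i u *: f (basis i) v).
  apply: eq_bigr => i _; rewrite {2}[v]basis_expand.
  rewrite -[f (basis i) _]/(gr (basis i) _) linear_sum scaler_sumr.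
  by apply: eq_bigr => j _; rewrite mxE linearZ scalerA.
rewrite {2}[u]basis_expand -[RHS]/(gl _) linear_sum.
by apply: eq_bigr => i _; rewrite linearZ.
Qed.

Lemma tensor_expand U V (t : tensor U V) :
  t = \sum_i \sum_j (t : 'M_(_, _)) i j *: (basis i \ox basis j).
Proof.
apply/matrixP=> k l.
rewrite summxE (bigD1 k) //= summxE (bigD1 l) //= !mxE !coord_basis !eqxx !mulr1.
rewrite big1 ?addr0 => [|j /negPf jl]; last by rewrite !mxE !coord_basis jl !mulr0.
rewrite big1 ?addr0 // => i /negPf ik; rewrite summxE big1 // => j _.
by rewrite !mxE !coord_basis ik mul0r mulr0.
Qed.

Lemma tlift_unique U V W (g h : 'Hom(tensor U V, W)) :
  (forall u v, g (u \ox v) = h (u \ox v)) -> g = h.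
Proof.
move=> gh; apply/lfunP => t; rewrite [t]tensor_expand !linear_sum.
apply: eq_bigr => i _; rewrite !linear_sum; apply: eq_bigr => j _.
by rewrite !linearZ /= gh.
Qed.

End TensorTheory.

Section TensorMaps.
Variable K : fieldType.
Implicit Types U V W X : vectType K.

Definition tmap U V W X (f : 'Hom(U, W)) (g : 'Hom(V, X)) :
  'Hom(tensor U V, tensor W X) := tlift (fun u v => f u \ox g v).

Definition tassoc U V W :
    'Hom(tensor (tensor U V) W, tensor U (tensor V W)) :=
  tlift (fun t w => tlift (fun u v => u \ox (v \ox w)) t).

(* The slice maps omega (x) iota and iota (x) omega, with values in V and U
   through the identifications of K (x) V with V and of U (x) K with U. *)
Definition slicel U V (omega : 'Hom(U, K^o)) : 'Hom(tensor U V, V) :=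
  tlift (fun u v => omega u *: v).

Definition slicer U V (omega : 'Hom(V, K^o)) : 'Hom(tensor U V, U) :=
  tlift (fun u v => omega v *: u).

Definition tfunctional U V (f : 'Hom(U, K^o)) (g : 'Hom(V, K^o)) :
  'Hom(tensor U V, K^o) := tlift (fun u v => f u * g v : K^o).

(* The product of the algebra A (x) A. *)
Definition tmul (A : falgType K) (s t : tensor A A) : tensor A A :=
  tlift (fun a a' => tlift (fun c c' => (a * c) \ox (a' * c')) t) s.

Lemma tfunctionalE U V (f : 'Hom(U, K^o)) (g : 'Hom(V, K^o)) u v :
  tfunctional f g (u \ox v) = f u * g v.
Proof.
apply: tliftE => [y|x] a b c; rewrite linearP.
  by rewrite mulrDl /= -scalerAl.
by rewrite mulrDr /= -scalerAr.
Qed.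

Lemma tmapE U V W X (f : 'Hom(U, W)) (g : 'Hom(V, X)) u v :
  tmap f g (u \ox v) = f u \ox g v.
Proof.
apply: tliftE => [y|x] a b c; rewrite linearP.
  exact: tensor_linearl.
exact: tensor_linearr.
Qed.

Lemma slicelE U V (omega : 'Hom(U, K^o)) (u : U) (v : V) :
  slicel V omega (u \ox v) = omega u *: v.
Proof.
apply: tliftE => [y|x] a b c; first by rewrite linearP scalerDl /= -scalerA.
by rewrite scalerDr !scalerA mulrC.
Qed.

Lemma slicerE U V (omega : 'Hom(V, K^o)) (u : U) (v : V) :
  slicer U omega (u \ox v) = omega v *: u.
Proof.
apply: tliftE => [y|x] a b c; last by rewrite linearP scalerDl /= -scalerA.
by rewrite scalerDr !scalerA mulrC.
Qed.

Lemma tassocE U V W (u : U) (v : V) (w : W) :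
  tassoc U V W ((u \ox v) \ox w) = u \ox (v \ox w).
Proof.
have E t w' : tlift (fun u v => u \ox (v \ox w')) t =
    \sum_i \sum_j (t : 'M_(_, _)) i j *:
      (@basis K U i \ox (@basis K V j \ox w')).
  by rewrite lfunE.
rewrite /tassoc tliftE => [|w'|t].
- apply: (tliftE (f := fun u v => u \ox (v \ox w))) => [y|x] a b c.
    exact: tensor_linearl.
  by rewrite tensor_linearl tensor_linearr.
- by move=> a s t; rewrite linearP.
- move=> a x y; rewrite !E scaler_sumr -big_split; apply: eq_bigr => i _.
  rewrite scaler_sumr -big_split; apply: eq_bigr => j _ /=.
  by rewrite !tensor_linearr scalerDr !scalerA mulrC.
Qed.

Lemma tmulE (A : falgType K) (a a' c c' : A) :
  tmul (a \ox a') (c \ox c') = (a * c) \ox (a' * c').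
Proof.
have bl (x x' : A) :
    tlift (fun c c' => (x * c) \ox (x' * c')) (c \ox c') = (x * c) \ox (x' * c').
  apply: (tliftE (f := fun c c' => (x * c) \ox (x' * c'))) => [y|y] k u v.
    by rewrite mulrDr -scalerAr tensor_linearl.
  by rewrite mulrDr -scalerAr tensor_linearr.
rewrite /tmul; pose f (x x' : A) :=
  tlift (fun c c' => (x * c) \ox (x' * c')) (c \ox c').
rewrite -[RHS]bl -/(f a a').
apply: (tliftE (f := f)) => [y|y] k u v; rewrite /f !bl.
  by rewrite mulrDl -scalerAl tensor_linearl.
by rewrite mulrDl -scalerAl tensor_linearr.
Qed.

Lemma tlift_unique3 U V W X (g h : 'Hom(tensor (tensor U V) W, X)) :
  (forall u v w, g ((u \ox v) \ox w) = h ((u \ox v) \ox w)) -> g = h.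
Proof.
move=> gh; apply: tlift_unique => t w; rewrite [t]tensor_expand.
pose tw := HB.pack (fun t : tensor U V => t \ox w)
  (GRing.isSemilinear.Build K (tensor U V) (tensor (tensor U V) W) _
    (fun t : tensor U V => t \ox w)
    (GRing.semilinear_linear (tensor_linearl w))) :
  {linear tensor U V -> tensor (tensor U V) W}.
rewrite -[_ \ox w]/(tw _) !linear_sum; apply: eq_bigr => i _.
rewrite !linear_sum; apply: eq_bigr => j _.
by rewrite !linearZ /= gh.
Qed.

End TensorMaps.

Section Hypergroup.
Variables (K : fieldType) (A : falgType K) (Delta : 'Hom(A, tensor A A)).

Definition coassociative := forall a,
  tassoc A A A (tmap Delta \1 (Delta a)) = tmap \1 Delta (Delta a).

Definition is_counit (eps : 'Hom(A, K^o)) := forall a,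
  slicel A eps (Delta a) = a /\ slicer A eps (Delta a) = a.

Definition faithful (omega : 'Hom(A, K^o)) :=
  (forall a, (forall c, omega (a * c) = 0) -> a = 0) /\
  (forall c, (forall a, omega (a * c) = 0) -> c = 0).

Definition is_antipode (phi : 'Hom(A, K^o)) (S : 'End(A)) := forall a c,
  S (slicer A phi (tmul (Delta a) (1 \ox c))) =
  slicer A phi (tmul (1 \ox a) (Delta c)).

Definition left_integral (phi : 'Hom(A, K^o)) := exists S, is_antipode phi S.

Definition anti_isomorphism (S : 'End(A)) :=
  bijective S /\ (forall x y, S (x * y) = S y * S x).

Record finite_quantum_hypergroup : Prop := FiniteQuantumHypergroup {
  fqh_coassoc : coassociative;
  fqh_comul1 : Delta 1 = 1 \ox 1;
  fqh_counit : exists2 eps : 'Hom(A, K^o),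
    is_counit eps & monoid_morphism eps;
  fqh_integral : exists phi : 'Hom(A, K^o),
    [/\ faithful phi, left_integral phi &
      forall S, is_antipode phi S -> anti_isomorphism S]
}.

End Hypergroup.

Section Dual.
Variables (K : fieldType) (A : falgType K) (Delta : 'Hom(A, tensor A A)).

Lemma counit_unique (eps eps' : 'Hom(A, K^o)) :
  is_counit Delta eps -> is_counit Delta eps' -> eps = eps'.
Proof.
move=> ce ce'; apply/lfunP => a.
rewrite -{1}(ce' a).1 -[in RHS](ce a).2.
suff /lfunP/(_ (Delta a)) : (eps \o slicel A eps' = eps' \o slicer A eps)%VF.
  by rewrite !comp_lfunE.
apply: tlift_unique => u v; rewrite !comp_lfunE slicelE slicerE !linearZ.
exact: mulrC.
Qed.

Hypothesis H : finite_quantum_hypergroup Delta.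

Definition counit : 'Hom(A, K^o) := sval (cid2 (fqh_counit H)).

Lemma counitP : is_counit Delta counit.
Proof. by rewrite /counit; case: cid2. Qed.

Lemma counit_morph : monoid_morphism counit.
Proof. by rewrite /counit; case: cid2. Qed.

(* The dual space of A.  It depends on H because its product is associative and
   unital only as Delta is coassociative and has a counit. *)
Definition dual : Type := let _ := H in 'Hom(A, K^o).

HB.instance Definition _ := Vector.copy dual 'Hom(A, K^o).

Definition pairing (a : A) (b : dual) : K := (b : 'Hom(A, K^o)) a.

Definition dual_mul (b b' : dual) : dual := (tfunctional b b' \o Delta)%VF.

Fact dual_mulA : associative dual_mul.
Proof.
move=> b1 b2 b3; apply/lfunP => a; rewrite !comp_lfunE.
have E1 : tfunctional b1 (dual_mul b2 b3) =
    (tfunctional b1 (tfunctional b2 b3) \o tmap \1 Delta)%VF.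
  apply: tlift_unique => u v.
  by rewrite comp_lfunE tmapE !tfunctionalE id_lfunE comp_lfunE.
have E2 : tfunctional (dual_mul b1 b2) b3 =
    (tfunctional (tfunctional b1 b2) b3 \o tmap Delta \1)%VF.
  apply: tlift_unique => u v.
  by rewrite comp_lfunE tmapE !tfunctionalE id_lfunE comp_lfunE.
have E3 : tfunctional (tfunctional b1 b2) b3 =
    (tfunctional b1 (tfunctional b2 b3) \o tassoc A A A)%VF.
  apply: tlift_unique3 => u v w.
  by rewrite comp_lfunE tassocE !tfunctionalE mulrA.
by rewrite E1 E2 E3 !comp_lfunE fqh_coassoc.
Qed.

Fact dual_mul1 : left_id (counit : dual) dual_mul.
Proof.
move=> b; apply/lfunP => a; rewrite comp_lfunE -[in RHS](counitP a).1.
suff -> : tfunctional counit b = (b \o slicel A counit)%VF by rewrite comp_lfunE.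
by apply: tlift_unique => u v; rewrite comp_lfunE tfunctionalE slicelE linearZ.
Qed.

Fact dual_mulr1 : right_id (counit : dual) dual_mul.
Proof.
move=> b; apply/lfunP => a; rewrite comp_lfunE -[in RHS](counitP a).2.
suff -> : tfunctional b counit = (b \o slicer A counit)%VF by rewrite comp_lfunE.
apply: tlift_unique => u v; rewrite comp_lfunE tfunctionalE slicerE linearZ.
exact: mulrC.
Qed.

Fact dual_mulPl k (b1 b2 b : dual) :
  dual_mul (k *: b1 + b2) b = k *: dual_mul b1 b + dual_mul b2 b.
Proof.
apply/lfunP => a; rewrite add_lfunE scale_lfunE !comp_lfunE.
rewrite -scale_lfunE -add_lfunE; congr (fun_of_lfun _ _).
apply: tlift_unique => u v.
rewrite add_lfunE scale_lfunE !tfunctionalE add_lfunE scale_lfunE.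
by rewrite mulrDl -scalerAl.
Qed.

Fact dual_mulPr k (b1 b2 b : dual) :
  dual_mul b (k *: b1 + b2) = k *: dual_mul b b1 + dual_mul b b2.
Proof.
apply/lfunP => a; rewrite add_lfunE scale_lfunE !comp_lfunE.
rewrite -scale_lfunE -add_lfunE; congr (fun_of_lfun _ _).
apply: tlift_unique => u v.
rewrite add_lfunE scale_lfunE !tfunctionalE add_lfunE scale_lfunE.
by rewrite mulrDr -scalerAr.
Qed.

Fact dual_mulDl : left_distributive dual_mul +%R.
Proof. by move=> b1 b2 b; have := dual_mulPl 1 b1 b2 b; rewrite !scale1r. Qed.

Fact dual_mulDr : right_distributive dual_mul +%R.
Proof. by move=> b b1 b2; have := dual_mulPr 1 b1 b2 b; rewrite !scale1r. Qed.

Fact dual_oner_neq0 : (counit : dual) != 0.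
Proof.
apply/eqP => /lfunP/(_ 1); rewrite counit_morph.1 lfunE /= => /eqP.
by rewrite oner_eq0.
Qed.

HB.instance Definition _ := GRing.Zmodule_isNzRing.Build dual
  dual_mulA dual_mul1 dual_mulr1 dual_mulDl dual_mulDr dual_oner_neq0.

Fact dual_scalerAl k (b b' : dual) : k *: (b * b') = (k *: b) * b'.
Proof.
have mul0 : 0 * b' = 0 by exact: mul0r.
by have := dual_mulPl k b 0 b'; rewrite -[dual_mul 0 b']/(0 * b') mul0 !addr0.
Qed.

HB.instance Definition _ := GRing.Lmodule_isLalgebra.Build K dual dual_scalerAl.

Fact dual_scalerAr k (b b' : dual) : k *: (b * b') = b * (k *: b').
Proof.
have mul0 : b * 0 = 0 by exact: mulr0.
by have := dual_mulPr k b' 0 b; rewrite -[dual_mul b 0]/(b * 0) mul0 !addr0.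
Qed.

HB.instance Definition _ := GRing.Lalgebra_isAlgebra.Build K dual dual_scalerAr.
HB.instance Definition _ := Algebra_isFalgebra.Build K dual.

(* The pairing of A (x) A with B (x) B, where B is the dual of A. *)
Definition tpairing (t : tensor A A) (s : tensor dual dual) : K :=
  tlift (fun b b' : dual => tfunctional b b' t) s.

Definition dual_basis (i : 'I_(\dim {:A})) : dual :=
  linfun (coord (vbasis {:A}) i : A -> K^o).

Definition dual_coproduct_fun (b : dual) : tensor dual dual :=
  \sum_i \sum_j
    pairing (basis i * basis j) b *: (dual_basis i \ox dual_basis j).

Fact dual_coproduct_fun_linear : linear dual_coproduct_fun.
Proof.
move=> k b c; rewrite /dual_coproduct_fun scaler_sumr -big_split.
apply: eq_bigr => i _; rewrite scaler_sumr -big_split; apply: eq_bigr => j _ /=.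
by rewrite /pairing add_lfunE scale_lfunE scalerDl scalerA.
Qed.
HB.instance Definition _ :=
  GRing.isSemilinear.Build K dual (tensor dual dual) _ dual_coproduct_fun
    (GRing.semilinear_linear dual_coproduct_fun_linear).

(* The coproduct of the dual: the adjoint of the product of A.  That adjointness
   determines it is dual_coproductE with dual_coproduct_unique. *)
Definition dual_coproduct : 'Hom(dual : vectType K, tensor dual dual) :=
  linfun dual_coproduct_fun.

Lemma tpairingE (a a' : A) (b b' : dual) :
  tpairing (a \ox a') (b \ox b') = pairing a b * pairing a' b'.
Proof.
rewrite /tpairing tliftE ?tfunctionalE // => [y|y] k u v;
  rewrite !tfunctionalE add_lfunE scale_lfunE.
  by rewrite mulrDl -scalerAl.
by rewrite mulrDr -scalerAr.
Qed.

Lemma dual_mulE (a : A) (b b' : dual) :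
  pairing a (b * b') = tpairing (Delta a) (b \ox b').
Proof.
rewrite /pairing [LHS]comp_lfunE.
set t := Delta a; rewrite [t]tensor_expand.
rewrite linear_sum /tpairing tliftE; first by rewrite linear_sum.
  move=> y k u v; rewrite -scale_lfunE -add_lfunE; congr (fun_of_lfun _ _).
  apply: tlift_unique => x x'; rewrite add_lfunE scale_lfunE !tfunctionalE.
  by rewrite add_lfunE scale_lfunE mulrDl -scalerAl.
move=> y k u v; rewrite -scale_lfunE -add_lfunE; congr (fun_of_lfun _ _).
apply: tlift_unique => x x'; rewrite add_lfunE scale_lfunE !tfunctionalE.
by rewrite add_lfunE scale_lfunE mulrDr -scalerAr.
Qed.

Lemma dual1E (a : A) : pairing a 1 = counit a.
Proof. by []. Qed.

Lemma dual_basisE i (a : A) :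
  pairing a (dual_basis i) = coord (vbasis {:A}) i a.
Proof. by rewrite /pairing lfunE. Qed.

Lemma dual_coproductE (a a' : A) (b : dual) :
  tpairing (a \ox a') (dual_coproduct b) = pairing (a * a') b.
Proof.
rewrite /tpairing [dual_coproduct b]lfunE /= /dual_coproduct_fun linear_sum.
rewrite [in RHS](basis_expand a) mulr_suml /pairing linear_sum.
apply: eq_bigr => i _; rewrite [in RHS](basis_expand a') mulr_sumr !linear_sum.
apply: eq_bigr => j _; rewrite [LHS]linearZ -scalerAl -scalerAr !linearZ /= -/(tpairing _ _).
by rewrite tpairingE !dual_basisE [LHS]mulrC -mulrA.
Qed.

Lemma dual_expand (b : dual) : b = \sum_i pairing (basis i) b *: dual_basis i.
Proof.
apply/lfunP => a; rewrite {1}[a]basis_expand linear_sum sum_lfunE.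
apply: eq_bigr => i _; rewrite linearZ scale_lfunE.
by rewrite -[X in _ = _ *: X]/(pairing _ _) dual_basisE; exact: mulrC.
Qed.

Lemma tpairing_nondeg (s s' : tensor dual dual) :
  (forall a a', tpairing (a \ox a') s = tpairing (a \ox a') s') -> s = s'.
Proof.
pose F s := \sum_i \sum_j
  tpairing (basis i \ox basis j) s *: (dual_basis i \ox dual_basis j).
have Fl : linear F.
  move=> k t u; rewrite /F scaler_sumr -big_split; apply: eq_bigr => i _.
  rewrite scaler_sumr -big_split; apply: eq_bigr => j _ /=.
  by rewrite /tpairing linearP scalerDl scalerA.
pose G := HB.pack F (GRing.isSemilinear.Build K (tensor dual dual)
  (tensor dual dual) _ F (GRing.semilinear_linear Fl)) :
  {linear tensor dual dual -> tensor dual dual}.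
have FK t : F t = t.
  suff /lfunP/(_ t) : linfun G = \1%VF by rewrite lfunE id_lfunE.
  apply: tlift_unique => b b'; rewrite lfunE id_lfunE /= /F.
  apply/matrixP => k l; rewrite !mxE {2}[b]dual_expand {2}[b']dual_expand.
  rewrite !linear_sum mulr_suml summxE; apply: eq_bigr => i _.
  rewrite mulr_sumr summxE; apply: eq_bigr => j _.
  by rewrite !mxE tpairingE !linearZ /= mulrACA.
move=> ss'; rewrite -(FK s) -(FK s') /F; apply: eq_bigr => i _.
by apply: eq_bigr => j _; rewrite ss'.
Qed.

Lemma dual_coproduct_unique (D : 'Hom(dual : vectType K, tensor dual dual)) :
  (forall a a' b, tpairing (a \ox a') (D b) = pairing (a * a') b) ->
  D = dual_coproduct.
Proof.
move=> adjD; apply/lfunP => b; apply: tpairing_nondeg => a a'.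
by rewrite adjD dual_coproductE.
Qed.

End Dual.

(* Main.v *)
From HB Require Import structures.
Require Import Defs.
From mathcomp Require Import all_boot all_algebra all_field.
From mathcomp Require Import complex reals.

(* Let phi be a faithful left integral on A with antipode S.  By faithfulness
   there is h with phi(c h) = eps(c), hence c h = eps(c) h, and the relation
   defining S at c = h gives S(a) = (iota (x) phi)((1 (x) a) Delta(h)).  The
   left integral on the dual is evaluation at h, with antipode b |-> b o S:
   - the antipode relation on the dual amounts to
     (1 (x) a) Delta(h) = (S(a) (x) 1) Delta(h), which follows from
     S(ca) = S(a)S(c) by slicing with phi(c .);
   - b |-> b o S reverses products because S reverses coproducts; this follows
     from associativity of the product of the dual, applied to b, d and
     phi(a .) at h, since d phi(a .) is again of the form phi(a' .). *)

Set Implicit Arguments.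
Unset Strict Implicit.
Unset Printing Implicit Defensive.

Import GRing.Theory.
Local Open Scope ring_scope.

(** * Slices, product functionals and separation of tensors *)

Section TensorSlices.
Variable K : fieldType.
Implicit Types U V W X : vectType K.

Lemma tfunctional_slicer U V (f : 'Hom(U, K^o)) (g : 'Hom(V, K^o)) t :
  tfunctional f g t = f (slicer U g t).
Proof.
suff -> : tfunctional f g = (f \o slicer U g)%VF by rewrite comp_lfunE.
apply: tlift_unique => u v.
by rewrite comp_lfunE tfunctionalE slicerE linearZ; exact: mulrC.
Qed.

Lemma tfunctional_slicel U V (f : 'Hom(U, K^o)) (g : 'Hom(V, K^o)) t :
  tfunctional f g t = g (slicel V f t).
Proof.
suff -> : tfunctional f g = (g \o slicel V f)%VF by rewrite comp_lfunE.
by apply: tlift_unique => u v; rewrite comp_lfunE tfunctionalE slicelE linearZ.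
Qed.

Lemma tfunctional_tmap U V W X (f : 'Hom(W, K^o)) (g : 'Hom(X, K^o))
    (f' : 'Hom(U, W)) (g' : 'Hom(V, X)) t :
  tfunctional f g (tmap f' g' t) = tfunctional (f \o f')%VF (g \o g')%VF t.
Proof.
rewrite -comp_lfunE; congr (fun_of_lfun _ t).
apply: tlift_unique => u v.
by rewrite comp_lfunE tmapE !tfunctionalE !comp_lfunE.
Qed.

Lemma slicer_tmap U V W X (g : 'Hom(X, K^o)) (f' : 'Hom(U, W))
    (g' : 'Hom(V, X)) t :
  slicer W g (tmap f' g' t) = f' (slicer U (g \o g')%VF t).
Proof.
rewrite -[LHS]comp_lfunE -[RHS]comp_lfunE; congr (fun_of_lfun _ t).
apply: tlift_unique => u v.
by rewrite !comp_lfunE tmapE !slicerE linearZ comp_lfunE.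
Qed.

Lemma tfunctional_tassoc U V W (f : 'Hom(U, K^o)) (g : 'Hom(V, K^o))
    (k : 'Hom(W, K^o)) t :
  tfunctional f (tfunctional g k) (tassoc U V W t) =
  tfunctional (tfunctional f g) k t.
Proof.
rewrite -comp_lfunE; congr (fun_of_lfun _ t); apply: tlift_unique3 => u v w.
by rewrite comp_lfunE tassocE !tfunctionalE mulrA.
Qed.

(** Products of coordinate functionals read off the matrix entries that represent a tensor. *)
Lemma tensor_separated U V (s t : tensor U V) :
  (forall f g, tfunctional f g s = tfunctional f g t) -> s = t.
Proof.
move=> st; apply/matrixP => i j.
pose f := linfun (coord (vbasis {:U}) i : U -> K^o).
pose g := linfun (coord (vbasis {:V}) j : V -> K^o).
have E r : tfunctional f g r = (r : 'M_(_, _)) i j.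
  rewrite [LHS]lfunE /= /tlift_fun.
  rewrite (bigD1 i) //= (bigD1 j) //= !lfunE /= !Defs.coord_basis !eqxx mulr1.
  rewrite [X in X + _ + _]mulr1.
  rewrite big1 ?addr0 => [|l /negPf lj]; last first.
    by rewrite !lfunE /= !Defs.coord_basis lj mulr0 scaler0.
  rewrite big1 ?addr0 // => l /negPf li; rewrite big1 // => k _.
  by rewrite !lfunE /= !Defs.coord_basis li mul0r scaler0.
by rewrite -!E.
Qed.

Lemma tensor_separated3 U V W (s t : tensor U (tensor V W)) :
  (forall f g k, tfunctional f (tfunctional g k) s =
                 tfunctional f (tfunctional g k) t) -> s = t.
Proof.
move=> st; apply: tensor_separated => f g; rewrite !tfunctional_slicel.
congr (g _); apply: tensor_separated => f' g'.
by rewrite -!tfunctional_slicel.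
Qed.

(** Here the elementary tensor is the argument of the outer lift of [tmul], so bilinearity of the
    inner lift in [a] and [a'] has to be checked. Together with [tmul_tensr], this lets the products
    in the antipode relation be absorbed into the functional being sliced. *)
Lemma tmul_tensl (A : falgType K) (a a' : A) (t : tensor A A) :
  tmul (a \ox a') t = tmap (amull a) (amull a') t.
Proof.
have bl (x x' : A) : tlift (fun c c' => (x * c) \ox (x' * c')) =
    tmap (amull x) (amull x').
  apply: tlift_unique => c c'.
  rewrite tmapE [amull x c]lfunE [amull x' c']lfunE /=.
  apply: (tliftE (f := fun c c' => (x * c) \ox (x' * c'))) => [y|y] k u v.
    by rewrite mulrDr -scalerAr tensor_linearl.
  by rewrite mulrDr -scalerAr tensor_linearr.
pose f (x x' : A) := tlift (fun c c' => (x * c) \ox (x' * c')) t.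
rewrite -bl -/(f a a').
apply: (tliftE (f := f)) => [y|y] k u v;
  rewrite /f !bl -scale_lfunE -add_lfunE; congr (fun_of_lfun _ t);
  apply: tlift_unique => x x'.
  rewrite add_lfunE scale_lfunE !tmapE !lfunE /=.
  by rewrite mulrDl -scalerAl tensor_linearl.
rewrite add_lfunE scale_lfunE !tmapE !lfunE /=.
by rewrite mulrDl -scalerAl tensor_linearr.
Qed.

Lemma tmul_tensr (A : falgType K) (c c' : A) (t : tensor A A) :
  tmul t (c \ox c') = tmap (amulr c) (amulr c') t.
Proof.
pose f (x x' : A) := tlift (fun c c' => (x * c) \ox (x' * c')) (c \ox c').
rewrite -[LHS]/(tlift f t); congr (fun_of_lfun _ t).
apply: tlift_unique => u v; rewrite tmapE !lfunE /= -tmulE.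
exact: (esym (lfunE _ _)).
Qed.

Lemma amulr1 (A : falgType K) : amulr 1 = \1%VF :> 'End(A).
Proof. by apply/lfunP => x; rewrite !lfunE /= mulr1. Qed.

End TensorSlices.

(** * Faithful functionals represent the whole dual space *)

Section FaithfulFunctional.
Variable K : fieldType.
Implicit Type A : falgType K.

Lemma lker0_surjective (U V : vectType K) (f : 'Hom(U, V)) :
  \dim {:U} = \dim {:V} -> (forall u, f u = 0 -> u = 0) ->
  forall v, exists u, f u = v.
Proof.
move=> dimUV f0 v.
have kf : lker f = 0%VS.
  apply/eqP; rewrite -subv0; apply/subvP => u.
  by rewrite memv_ker memv0 => /eqP/f0->.
have /eqP imf : limg f == fullv.
  rewrite eqEdim subvf /= -dimUV -(limg_ker_dim f fullv).
  by rewrite kf capv0 dimv0 add0n.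
by have /memv_imgP[u _ ->] : v \in limg f; [rewrite imf memvf | exists u].
Qed.

(** The hypothesis says that [c |-> phi \o m c] is injective; since [A] and its dual have the same
    dimension, it is also surjective. It is applied with [m] equal to [amull] or [amulr], one for
    each half of faithfulness. *)
Lemma functional_repr A (phi : 'Hom(A, K^o)) (m : {linear A -> 'End(A)}) :
  (forall u, (forall c, phi (m u c) = 0) -> u = 0) ->
  forall b : 'Hom(A, K^o), exists c, b = (phi \o m c)%VF.
Proof.
move=> m0 b; pose F c := (phi \o m c)%VF : 'Hom(A, K^o).
have Fl : linear F.
  by move=> k x y; rewrite /F linearP comp_lfunDr comp_lfunZr.
pose G := HB.pack F (GRing.isSemilinear.Build K A 'Hom(A, K^o) _ F
  (GRing.semilinear_linear Fl)) : {linear A -> 'Hom(A, K^o)}.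
have dimA : \dim {:A} = \dim {:'Hom(A, K^o)} by rewrite !dimvf /dim /= muln1.
have [u|c <-] := lker0_surjective (f := linfun G) dimA _ b.
  rewrite lfunE /= => /lfunP F0; apply: m0 => c.
  by have := F0 c; rewrite /F comp_lfunE lfunE.
by exists c; rewrite lfunE.
Qed.

Lemma faithful_reprl A (phi b : 'Hom(A, K^o)) :
  faithful phi -> exists c, b = (phi \o amull c)%VF.
Proof.
move=> phiF; apply: functional_repr => u u0; apply: phiF.1 => c.
by rewrite -(u0 c) lfunE.
Qed.

Lemma faithful_reprr A (phi b : 'Hom(A, K^o)) :
  faithful phi -> exists c, b = (phi \o amulr c)%VF.
Proof.
move=> phiF; apply: functional_repr => u u0; apply: phiF.2 => c.
by rewrite -(u0 c) lfunE.
Qed.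

End FaithfulFunctional.

(** * Coalgebra structure of the dual, tested by evaluations *)

Section DualHypergroup.
Variables (K : fieldType) (A : falgType K) (Delta : 'Hom(A, tensor A A)).
Hypothesis H : finite_quantum_hypergroup Delta.
Local Notation B := (dual H).
Implicit Types b d : B.


Fact pairing_linear (a : A) : linear (pairing a : B -> K^o).
Proof. by move=> k b d; rewrite /pairing add_lfunE scale_lfunE. Qed.

Definition eval (a : A) : 'Hom(B, K^o) :=
  linfun (HB.pack (pairing a : B -> K^o) (GRing.isSemilinear.Build K B K^o _
    (pairing a) (GRing.semilinear_linear (pairing_linear a))) :
    {linear B -> K^o}).

Lemma evalE a b : eval a b = pairing a b.
Proof. by rewrite lfunE. Qed.

Lemma eval_surj (f : 'Hom(B, K^o)) : exists a, f = eval a.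
Proof.
(* Reflexivity: the coordinates of the point are the values of [f] on the dual basis. *)
exists (\sum_i f (dual_basis H i) *: basis i); apply/lfunP => b.
rewrite evalE {1}[b]dual_expand linear_sum /pairing linear_sum.
by apply: eq_bigr => i _; rewrite !linearZ; exact: mulrC.
Qed.

Lemma tpairing_eval a a' (s : tensor B B) :
  tpairing (a \ox a') s = tfunctional (eval a) (eval a') s.
Proof.
suff /lfunP/(_ s) : tlift (fun b b' : B => tfunctional b b' (a \ox a')) =
  tfunctional (eval a) (eval a') by [].
apply: tlift_unique => b b'.
by rewrite -[LHS]/(tpairing _ _) tpairingE tfunctionalE !evalE.
Qed.

Lemma tfunctional_coproduct a a' :
  (tfunctional (eval a) (eval a') \o dual_coproduct H)%VF = eval (a * a').
Proof.
by apply/lfunP => b; rewrite comp_lfunE -tpairing_eval dual_coproductE evalE.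
Qed.

Lemma pairing_mul a b b' : pairing a (b * b' : B) = tfunctional b b' (Delta a).
Proof. by rewrite /pairing [LHS]comp_lfunE. Qed.

(** Tested on three evaluations, which exhaust the functionals on the dual, both sides become
    evaluation at a triple product in [A]. *)
Lemma dual_coassociative : coassociative (dual_coproduct H).
Proof.
move=> b; apply: tensor_separated3 => f g k.
have [x ->] := eval_surj f; have [y ->] := eval_surj g.
have [z ->] := eval_surj k.
rewrite tfunctional_tassoc !tfunctional_tmap !tfunctional_coproduct.
rewrite !comp_lfun1r -!comp_lfunE !tfunctional_coproduct.
by rewrite mulrA.
Qed.

(** The unit of the dual is the counit of [A], so this is multiplicativity of that counit. *)
Lemma dual_comul1 : dual_coproduct H 1 = 1 \ox 1.
Proof.
apply: tpairing_nondeg => a a'.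
by rewrite dual_coproductE tpairingE !dual1E (counit_morph H).2.
Qed.

Lemma dual_counit : is_counit (dual_coproduct H) (eval 1).
Proof.
move=> b; split; apply/lfunP => a;
  rewrite -![fun_of_lfun _ a]/(pairing a _) -!evalE.
  rewrite -tfunctional_slicel -comp_lfunE tfunctional_coproduct.
  by rewrite mul1r.
rewrite -tfunctional_slicer -comp_lfunE tfunctional_coproduct.
by rewrite mulr1.
Qed.

(** Multiplicativity of evaluation at [1] comes from [Delta 1 = 1 \ox 1]. *)
Lemma eval1_monoid_morphism : monoid_morphism (eval 1).
Proof.
split=> [|b b']; rewrite !evalE; first by rewrite dual1E (counit_morph H).1.
by rewrite pairing_mul (fqh_comul1 H) tfunctionalE.
Qed.

(** * The integral on the dual: evaluation at [h] *)

Variables (phi : 'Hom(A, K^o)) (S : 'End(A)).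
Hypotheses (phiF : faithful phi) (phiS : is_antipode Delta phi S).
Hypothesis antiS : anti_isomorphism S.

Lemma antipodeE a c :
  S (slicer A (phi \o amulr c)%VF (Delta a)) =
  slicer A (phi \o amull a)%VF (Delta c).
Proof.
have := phiS a c; rewrite tmul_tensl tmul_tensr !slicer_tmap amull1 amulr1.
by rewrite !id_lfunE.
Qed.

Variable h : A.
Hypothesis hP : (phi \o amulr h)%VF = counit H.

Lemma slicer_cointegral a : slicer A (phi \o amull a)%VF (Delta h) = S a.
Proof. by rewrite -antipodeE hP (counitP H a).2. Qed.

(** The product of b and phi(a .) takes the value b(S(a)) at [h], so surjectivity of [S] gives the
    first half. For d = phi(c .), the product of phi(x .) and d takes the value phi(x S(c)) at [h];
    faithfulness of [phi] and injectivity of [S] then give c = 0. *)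
Lemma cointegral_faithful : faithful (eval h).
Proof.
split=> [b b0|d d0]; apply/lfunP => a; rewrite [RHS]lfunE /=.
  have [[T _ TK] _] := antiS; rewrite -(TK a) -slicer_cointegral.
  by rewrite -tfunctional_slicer -pairing_mul -evalE b0.
have [c dE] := faithful_reprl d phiF.
suff c0 : c = 0 by rewrite dE c0 comp_lfunE lfunE /= mul0r linear0.
have [[T SK _] _] := antiS; rewrite -(SK c) -[RHS](SK 0); congr T.
rewrite linear0; apply: phiF.2 => x.
have := d0 (phi \o amull x)%VF; rewrite evalE pairing_mul tfunctional_slicer dE.
by rewrite slicer_cointegral comp_lfunE lfunE.
Qed.

Lemma cointegral_amull b :
  (eval h \o amull b)%VF = eval (slicel A b (Delta h)).
Proof.
apply/lfunP => d.
by rewrite comp_lfunE !evalE lfunE /= pairing_mul tfunctional_slicel.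
Qed.

Lemma cointegral_amulr d :
  (eval h \o amulr d)%VF = eval (slicer A d (Delta h)).
Proof.
apply/lfunP => b.
by rewrite comp_lfunE !evalE lfunE /= pairing_mul tfunctional_slicer.
Qed.

Lemma pairing_slicer_mull a b d :
  pairing a (slicer B (eval h) (tmul (1 \ox b) (dual_coproduct H d))) =
  pairing (a * slicel A b (Delta h)) d.
Proof.
rewrite -evalE -tfunctional_slicer tmul_tensl tfunctional_tmap amull1.
by rewrite comp_lfun1r cointegral_amull -comp_lfunE tfunctional_coproduct evalE.
Qed.

Lemma pairing_slicer_mulr a b d :
  pairing a (slicer B (eval h) (tmul (dual_coproduct H b) (1 \ox d))) =
  pairing (a * slicer A d (Delta h)) b.
Proof.
rewrite -evalE -tfunctional_slicer tmul_tensr tfunctional_tmap amulr1.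
by rewrite comp_lfun1r cointegral_amulr -comp_lfunE tfunctional_coproduct evalE.
Qed.

(** * The antipode of the dual: the transpose of [S] *)

Fact transpose_linear : linear (fun b : B => (b \o S)%VF : B).
Proof. by move=> k b d; rewrite comp_lfunDl comp_lfunZl. Qed.

Definition transpose : 'End(B) :=
  linfun (HB.pack (fun b : B => (b \o S)%VF : B)
    (GRing.isSemilinear.Build K B B _ (fun b : B => (b \o S)%VF : B)
      (GRing.semilinear_linear transpose_linear)) : {linear B -> B}).

Lemma pairing_transpose a b : pairing a (transpose b) = pairing (S a) b.
Proof. by rewrite lfunE /= /pairing comp_lfunE. Qed.

(** Paired with a, the relation reads b(S(a) (iota (x) d)Delta(h)) = d(a (b (x) iota)Delta(h)). For
    d = phi(c .) both sides equal b(S(ca)), the left one because [S] reverses products. *)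
Lemma transpose_antipode :
  is_antipode (dual_coproduct H) (eval h) transpose.
Proof.
move=> b d; apply/lfunP => a; rewrite -![fun_of_lfun _ a]/(pairing a _).
rewrite pairing_transpose pairing_slicer_mull pairing_slicer_mulr.
have [c ->] := faithful_reprl d phiF.
rewrite slicer_cointegral /pairing -antiS.2 -slicer_cointegral.
rewrite -tfunctional_slicer tfunctional_slicel !comp_lfunE !lfunE /=.
by rewrite mulrA.
Qed.

Lemma transpose_bij : bijective transpose.
Proof.
have [[T SK TK] _] := antiS.
(* The linear inverse is a priori only a right inverse of [S] on its image; bijectivity of [S] makes
   it two-sided. *)
have TS x : (S^-1)%VF (S x) = x.
  by apply/(can_inj SK); apply: limg_lfunVK; rewrite memv_img ?memvf.
have ST x : S ((S^-1)%VF x) = x by rewrite -(TK x) TS.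
exists (fun b : B => (b \o S^-1)%VF : B) => b; apply/lfunP => a.
  rewrite [LHS]comp_lfunE -[LHS]/(pairing _ (transpose b)).
  by rewrite pairing_transpose /pairing ST.
by rewrite -[LHS]/(pairing _ _) pairing_transpose /pairing [LHS]comp_lfunE TS.
Qed.

(** The antipode relation carries the slice of Delta(x) by phi(a .) to [S] of a slice of Delta(a) by
    phi(. x), after which x occurs only inside [phi]. *)
Lemma mul_functional_amull a b :
  (b * (phi \o amull a)%VF : B) =
  (phi \o amull (slicel A (b \o S)%VF (Delta a)))%VF.
Proof.
apply/lfunP => x; rewrite -[LHS]/(pairing _ _) pairing_mul tfunctional_slicer.
rewrite -antipodeE -comp_lfunE -tfunctional_slicer tfunctional_slicel.
by rewrite !comp_lfunE !lfunE.
Qed.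

(** At a, the left side is (b d) phi(a .) evaluated at [h]. Reassociating and absorbing d gives b
    phi(a' .) at [h], that is b(S(a')), where a' is the left slice of Delta(a) by the transpose of
    d. *)
Lemma transposeM b d : transpose (b * d) = transpose d * transpose b.
Proof.
apply/lfunP => a; rewrite -![fun_of_lfun _ a]/(pairing a _).
rewrite pairing_transpose [RHS]pairing_mul tfunctional_slicel.
rewrite {1}/pairing -slicer_cointegral -tfunctional_slicer -pairing_mul.
rewrite -mulrA mul_functional_amull pairing_mul tfunctional_slicer.
by rewrite slicer_cointegral ![transpose _]lfunE /= [RHS]comp_lfunE.
Qed.

Lemma antipode1 : S 1 = 1.
Proof.
have [[T SK TK] SM] := antiS.
by rewrite -[LHS]mulr1 -{2}(TK 1) -SM mulr1 TK.
Qed.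

Lemma slicer_cointegral1 : slicer A phi (Delta h) = 1.
Proof.
rewrite -antipode1 -slicer_cointegral; congr (slicer _ _ _).
by apply/lfunP => x; rewrite comp_lfunE lfunE /= mul1r.
Qed.

Lemma dual_antipode_unique T :
  is_antipode (dual_coproduct H) (eval h) T -> T = transpose.
Proof.
move=> aT; apply/lfunP => b.
(* The choice d = [phi] makes the slice equal to b, because (iota (x) phi)Delta(h) = S(1) = 1; hence
   the antipode relation determines T(b). *)
suff <- : slicer B (eval h) (tmul (dual_coproduct H b) (1 \ox (phi : B))) = b.
  by rewrite aT transpose_antipode.
apply/lfunP => a; rewrite -![fun_of_lfun _ a]/(pairing a _).
by rewrite pairing_slicer_mulr slicer_cointegral1 mulr1.
Qed.

End DualHypergroup.

Lemma dual_finite_quantum_hypergroup (K : fieldType) (A : falgType K)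
    (Delta : 'Hom(A, tensor A A)) (H : finite_quantum_hypergroup Delta) :
  finite_quantum_hypergroup (dual_coproduct H).
Proof.
have [phi [phiF [S phiS] antiS]] := fqh_integral H.
have {}antiS := antiS S phiS.
have [h /esym hP] := faithful_reprr (counit H) phiF.
split.
- exact: dual_coassociative.
- exact: dual_comul1.
- by exists (eval H 1); [exact: dual_counit | exact: eval1_monoid_morphism].
exists (eval H h); split; first exact: cointegral_faithful hP.
  by exists (transpose H S); exact: transpose_antipode hP.
(* The condition ranges over all antipodes of the integral; uniqueness reduces it to the
   transpose. *)
move=> T /(dual_antipode_unique phiF phiS antiS hP) ->; split.
  exact: transpose_bij.
exact: transposeM hP.
Qed.

Local Open Scope complex_scope.

Theorem theorem3p12 (R : realType) (A : falgType R[i])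
    (Delta : 'Hom(A, tensor A A)) (H : finite_quantum_hypergroup Delta) :
  finite_quantum_hypergroup (dual_coproduct H).
Proof. exact: dual_finite_quantum_hypergroup. Qed.
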